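(* (i) There is an instance $(G,c,r,m)$ for which the unrestricted MV-mTSP$_+$ with arbitrary tours (P1) and the unrestricted MV-mTSP$_+$ with disjoint tours (P2) have optimal solutions of different cost: $\mathsf{OPT}_{\mathrm{P1}}\neq\mathsf{OPT}_{\mathrm{P2}}$. (ii) There is an instance $(G,c,D,r)$ with $m=|D|$ for which the MV-mTSP$_+$ with arbitrary tours (P5) and the MV-mTSP$_+$ with disjoint tours (P6) have optimal solutions of different cost: $\mathsf{OPT}_{\mathrm{P5}}\neq\mathsf{OPT}_{\mathrm{P6}}$.
   Context: In all problems, $V$ is a finite vertex set; $G=(V,E)$ is the complete undirected graph on $V$, including a self-loop $vv$ at each $v$; $c(uv)\geq 0$ are symmetric costs (self-loop costs $c(vv)$ are not assumed to be zero) that are metric: $c(uw)\leq c(uv)+c(vw)$ for all $u,v,w\in V$, and $c(vv)\leq 2\min_{u\in V\setminus\{v\}}c(uv)$ for all $v\in V$. A multigraph is a multiset $X$ of edges (self-loops allowed) on $V$; $\operatorname{cost}(X)=\sum_{uv} x(uv)c(uv)$, where $x(uv)$ is the multiplicity of $uv$ in $X$. The degree $\dot\delta_X(v)$ counts each copy of the self-loop $vv$ twice. An MVTSP tour is a connected multigraph in which every degree is even; a multigraph with even degrees visits $v$ exactly $\dot\delta_X(v)/2$ times. Unrestricted problems: requests $r:V\to\mathbb{Z}_{\geq 1}$ and an integer $m\geq 1$ are given; a tour is non-empty if it has at least one edge. Find a minimum-cost $X$ visiting each $v\in V$ exactly $r(v)$ times such that: (P1) the edge multiset of $X$ can be partitioned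 into exactly $m$ non-empty, not necessarily vertex-disjoint MVTSP tours; (P2) $X$ has exactly $m$ connected components, each a non-empty MVTSP tour. Problems with depots: a set $D=\{d_1,\dots,d_m\}\subseteq V$ of depots (one per agent, $m=|D|$) and requests $r:V\setminus D\to\mathbb{Z}_{\geq 1}$ are given; each tour contains exactly one depot (the agent's own, different agents having different depots); a tour is non-empty if it contains a depot and at least one non-depot. Find a minimum-cost $X$ visiting each $v\in V\setminus D$ exactly $r(v)$ times (depots any positive number of times) such that: (P5) the edge multiset of $X$ can be partitioned into exactly $m$ non-empty, not necessarily vertex-disjoint MVTSP tours; (P6) $X$ has exactly $m$ connected components, each a non-empty MVTSP tour. $\mathsf{OPT}_{\mathrm{P}i}$ denotes the cost of an optimal solution to P$i$ (the instances asserted to exist are ones on which both problems are feasible). *)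

(* Defs.v *)
From mathcomp Require Import all_boot all_order all_algebra.
From mathcomp Require Import reals.

Set Implicit Arguments.
Unset Strict Implicit.
Unset Printing Implicit Defensive.

Import Order.TTheory GRing.Theory Num.Theory.

Local Open Scope ring_scope.

(* The edges of the complete graph on V with self-loops are the nonempty sets *)
(* of at most two vertices: [set u; v] encodes uv and the singleton [set v]   *)
(* encodes the loop vv. In particular uv and vu are the same edge, so that    *)
(* functions on edges are symmetric by construction.                          *)
Definition is_edge (V : finType) : pred {set V} := fun e => (0 < #|e| <= 2)%N.

Notation edge V := {e : {set V} | is_edge e}.

Lemma is_edge2 (V : finType) (u v : V) : is_edge [set u; v].
Proof. by rewrite /is_edge cards2; case: eqP. Qed.

Definition mk_edge (V : finType) (u v : V) : edge V :=
  exist _ [set u; v] (is_edge2 u v).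

Definition ends (V : finType) (e : edge V) : {set V} := val e.

Definition is_loop (V : finType) (e : edge V) : bool := #|ends e| == 1%N.

(* [forall u, u != v -> _] expresses the bound by the minimum over u != v.    *)
Definition metric_cost (R : realType) (V : finType) (c : edge V -> R) : Prop :=
  [/\ forall e, 0 <= c e,
      forall u v w : V,
        c (mk_edge u w) <= c (mk_edge u v) + c (mk_edge v w)
    & forall v u : V, u != v -> c (mk_edge v v) <= 2 * c (mk_edge u v)].

(* A multiset of edges, given by its multiplicities. The pointwise sum of     *)
(* finite functions is the sum of multisets.                                  *)
Notation multigraph V := {ffun edge V -> nat}.

Section Multigraphs.

Variable V : finType.
Implicit Types (X T : multigraph V) (C D : {set V}) (u v : V) (r : V -> nat).

Definition cost (R : realType) (c : edge V -> R) X : R :=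
  \sum_(e : edge V) (X e)%:R * c e.

Definition degree X v : nat :=
  (\sum_(e : edge V | v \in ends e) (if is_loop e then 2 else 1) * X e)%N.

Definition visits X v (k : nat) : Prop := degree X v = (2 * k)%N.

Definition vertices X : {set V} := [set v | (0 < degree X v)%N].

Definition adj X : rel V := fun u v => (0 < X (mk_edge u v))%N.

(* Vertices without incident edges do not count for the connectedness of a    *)
(* tour, which usually meets only a part of V.                                *)
Definition connected X : Prop :=
  {in vertices X &, forall u v, connect (adj X) u v}.

Definition tour X : Prop := connected X /\ forall v, ~~ odd (degree X v).

Definition nonempty X : Prop := exists e, (0 < X e)%N.

(* The components of the graph (V, X), as sets of vertices: here a vertex     *)
(* without incident edges forms a component of its own.                       *)
Definition components X : {set {set V}} :=
  equivalence_partition (connect (adj X)) [set: V].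

Definition induced X C : multigraph V :=
  [ffun e => if ends e \subset C then X e else 0%N].

Definition arbitrary_tours r (m : nat) X : Prop :=
  (forall v, visits X v (r v)) /\
  exists T : 'I_m -> multigraph V,
    X = \sum_(i < m) T i /\ forall i, tour (T i) /\ nonempty (T i).

Definition disjoint_tours r (m : nat) X : Prop :=
  [/\ forall v, visits X v (r v),
      #|components X| = m
    & forall C, C \in components X ->
        tour (induced X C) /\ nonempty (induced X C)].

(* In the problems with depots, the values of r on D are irrelevant.          *)
Definition depot_visits D r X : Prop :=
  (forall v, v \notin D -> visits X v (r v)) /\
  (forall d, d \in D -> exists2 k, (0 < k)%N & visits X d k).

Definition depot_nonempty D X : Prop :=
  (exists2 d, d \in D & d \in vertices X) /\
  (exists2 v, v \notin D & v \in vertices X).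

(* The agents are identified with their depots: T d is the tour of the agent  *)
(* of d, for each of the #|D| elements d of D.                                *)
Definition depot_arbitrary_tours D r X : Prop :=
  depot_visits D r X /\
  exists T : V -> multigraph V,
    X = \sum_(d in D) T d /\
    forall d, d \in D ->
      [/\ tour (T d), vertices (T d) :&: D = [set d] & depot_nonempty D (T d)].

Definition depot_disjoint_tours D r X : Prop :=
  [/\ depot_visits D r X,
      #|components X| = #|D|
    & forall C, C \in components X ->
        [/\ tour (induced X C),
            #|vertices (induced X C) :&: D| = 1%N
          & depot_nonempty D (induced X C)]].

Definition is_opt (R : realType) (c : edge V -> R)
    (feasible : multigraph V -> Prop) (opt : R) : Prop :=
  exists X, [/\ feasible X, cost c X = opt
              & forall Y, feasible Y -> opt <= cost c Y].

End Multigraphs.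

(* Main.v *)
Require Import Defs.
From mathcomp Require Import all_boot all_order all_algebra.
From mathcomp Require Import reals.
From mathcomp Require Import zify.

Import Order.TTheory GRing.Theory Num.Theory.

Set Implicit Arguments.
Unset Strict Implicit.
Unset Printing Implicit Defensive.

Local Open Scope ring_scope.

(** Let every loop cost 2 and every other edge cost 1. Half of the
    degree sum is a lower bound for the cost, with equality in the absence of
    loops. Arbitrary tours may all pass through the same vertices, so they need
    no loops and attain this bound. If on the other hand S is a set with as many
    vertices as there are components and every component meets S, then no edge
    joins two vertices of S, and the whole degree sum over S is a lower bound.
    In (i), take two vertices, two tours and two visits each, so S consists of
    all the vertices: the optima are 4 and 8. In (ii), add a depot for each of
    the two tours and let S be the set of non-depots: the optima are 6 and 8. *)

Section Multigraphs.

Variable V : finType.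
Implicit Types (X Y T : multigraph V) (C D S : {set V}) (u v x : V).
Implicit Types (e : edge V) (s : seq V).

(** * Edges, adjacency, components and degrees *)

Lemma mk_edgeC u v : mk_edge u v = mk_edge v u.
Proof. by apply: val_inj; rewrite /= setUC. Qed.

Lemma mk_edgeP e : exists u v, e = mk_edge u v.
Proof.
case: e => A eA; have /andP[A1 A2] := eA.
have [/eqP/cards1P[u defA]|A_neq1] := eqVneq #|A| 1%N.
  by exists u, u; apply: val_inj; rewrite /= defA setUid.
have /cards2P[u [v [_ defA]]] : #|A| == 2%N by rewrite eqn_leq A2 ltn_neqAle eq_sym A_neq1.
by exists u, v; apply: val_inj.
Qed.

Lemma is_loop_mk_edge u v : is_loop (mk_edge u v) = (u == v).
Proof. by rewrite /is_loop /ends /= cards2; have [] := eqVneq u v. Qed.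

Lemma adj_sym X : symmetric (adj X).
Proof. by move=> u v; rewrite /adj mk_edgeC. Qed.

Lemma connect_adj_sym X : connect_sym (adj X).
Proof. exact/sym_connect_sym/adj_sym. Qed.

Lemma equivalence_connect X :
  {in [set: V] & &, equivalence_rel (connect (adj X))}.
Proof.
move=> x y z _ _ _; split=> [|xy]; first exact: connect0.
exact: (same_connect (@connect_adj_sym X) xy).
Qed.

Lemma components_partition X : partition (components X) [set: V].
Proof. exact/equivalence_partitionP/equivalence_connect. Qed.

Lemma degreeD X Y v : degree (X + Y) v = (degree X v + degree Y v)%N.
Proof.
by rewrite /degree -big_split; apply: eq_bigr => e _; rewrite ffunE mulnDr.
Qed.

Lemma degree0 v : degree (0 : multigraph V) v = 0%N.
Proof. by rewrite /degree big1 // => e _; rewrite ffunE muln0. Qed.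

Lemma degree_sum (I : finType) (P : pred I) (T : I -> multigraph V) v :
  degree (\sum_(i | P i) T i) v = (\sum_(i | P i) degree (T i) v)%N.
Proof.
exact: (big_morph (fun X => degree X v) (fun X Y => degreeD X Y v) (degree0 v)).
Qed.

Lemma degree_gt0 X v :
  (0 < degree X v)%N -> exists2 e, v \in ends e & (0 < X e)%N.
Proof.
rewrite lt0n sum_nat_eq0 negb_forall => /existsP[e].
rewrite negb_imply muln_eq0 negb_or => /and3P[ve _ Xe].
by exists e; rewrite ?lt0n.
Qed.

Lemma mem_vertices X e v : (0 < X e)%N -> v \in ends e -> v \in vertices X.
Proof.
move=> Xe ve; rewrite inE /degree (bigD1 e) //= addn_gt0 muln_gt0 Xe andbT.
by case: is_loop.
Qed.

Lemma vertices_induced X C : vertices (induced X C) \subset C.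
Proof.
apply/subsetP=> v; rewrite inE => /degree_gt0[e ve]; rewrite ffunE.
by case: ifP => // /subsetP/(_ _ ve).
Qed.

Lemma nonempty_vertices X : nonempty X <-> exists v, v \in vertices X.
Proof.
split=> [[e Xe]|[v]]; last by rewrite inE => /degree_gt0[e _ ?]; exists e.
have [u [v defe]] := mk_edgeP e; exists u; apply: mem_vertices Xe _.
by rewrite defe /ends /= set21.
Qed.

Lemma connect_adj_le X Y :
  (forall e, (X e <= Y e)%N) -> subrel (connect (adj X)) (connect (adj Y)).
Proof.
move=> leXY; apply: connect_sub => u v Xuv.
exact/connect1/(leq_trans Xuv).
Qed.

(** * Degree sums as lower bounds for the cost, and the structure of components *)

Lemma handshake X : (\sum_v degree X v = 2 * \sum_e X e)%N.
Proof.
rewrite /degree (exchange_big_dep xpredT) //= big_distrr /=.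
apply: eq_bigr => e _; rewrite sum_nat_const.
have [u [v ->]] := mk_edgeP e; rewrite is_loop_mk_edge.
by rewrite /ends /= cards2; case: eqP => _ /=; lia.
Qed.

(** The cost of [X] when loops cost 2 and other edges 1, kept in [nat] so that bounds and concrete
    values are plain arithmetic. *)
Definition loop_cost X : nat := (\sum_e X e * (is_loop e).+1)%N.

Lemma loop_costD X Y : loop_cost (X + Y) = (loop_cost X + loop_cost Y)%N.
Proof.
by rewrite /loop_cost -big_split; apply: eq_bigr => e _; rewrite ffunE mulnDl.
Qed.

Lemma loop_cost0 : loop_cost 0 = 0%N.
Proof. by rewrite /loop_cost big1 // => e _; rewrite ffunE. Qed.

Lemma loop_cost_sum (I : finType) (P : pred I) (T : I -> multigraph V) :
  loop_cost (\sum_(i | P i) T i) = (\sum_(i | P i) loop_cost (T i))%N.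
Proof.
exact: (big_morph (fun X => loop_cost X) loop_costD loop_cost0).
Qed.

(** Every edge, loop or not, adds 2 to the degree sum and costs at least 1. *)
Lemma sum_degree_le X : (\sum_v degree X v <= 2 * loop_cost X)%N.
Proof. by rewrite handshake leq_mul2l leq_sum // => e _; lia. Qed.

(** Edge by edge: a loop adds at most 2 to the degree sum over [S], which is its cost; any other
    edge that occurs has at most one end in [S], so it adds at most 1. *)
Lemma sum_degree_stable X S :
  {in S &, forall u v, u != v -> X (mk_edge u v) = 0%N} ->
  (\sum_(v in S) degree X v <= loop_cost X)%N.
Proof.
move=> stabS; rewrite /degree (exchange_big_dep xpredT) //= leq_sum // => e _.
rewrite sum_nat_const; have [u [v ->]] := mk_edgeP e.
(* With the multiplicity factored out, either it is 0 (left) or the remaining factors are compared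
   (right). *)
rewrite is_loop_mk_edge mulnA [leqLHS]mulnC leq_mul2l; apply/orP.
have -> : #|(fun x => (x \in S) && (x \in ends (mk_edge u v)))|
          = #|S :&: [set u; v]| by apply: eq_card => x; rewrite inE.
have [->|uv] := eqVneq u v.
  by right; rewrite -[leqRHS]/(1 * 2)%N leq_mul2r /= setUid -(cards1 v) subset_leq_card ?subsetIr.
rewrite muln1; have [/andP[uS vS]|] := boolP ((u \in S) && (v \in S)).
  by left; rewrite stabS.
rewrite negb_and => /orP[/negPf uS|/negPf vS]; right.
  rewrite -(cards1 v) subset_leq_card //; apply/subsetP=> x; rewrite !inE.
  by case: eqP => [->|]; rewrite ?uS // => _ /andP[].
rewrite -(cards1 u) subset_leq_card //; apply/subsetP=> x; rewrite !inE.
by rewrite orbC; case: eqP => [->|]; rewrite ?vS // => _ /andP[].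
Qed.

(** Sending a vertex to its component maps [S] onto a set of the same size, hence injectively; the
    ends of an edge share a component, so they cannot be distinct elements of [S]. *)
Lemma transversal_stable X S :
  #|components X| = #|S| ->
  (forall C, C \in components X -> exists2 v, v \in S & v \in C) ->
  {in S &, forall u v, u != v -> X (mk_edge u v) = 0%N}.
Proof.
move=> cardS meetS u v uS vS; apply: contra_neq_eq => Xuv.
have partX := components_partition X.
have [/eqP covX trivX _] := and3P partX.
have injS : {in S &, injective (pblock (components X))}.
  apply/imset_injP; rewrite -cardS; apply/eqP/eq_card => C.
  apply/imsetP/idP => [[x _ ->]|CX]; first by rewrite pblock_mem ?covX.
  have [x xS xC] := meetS C CX.
  by exists x => //; rewrite (def_pblock trivX CX xC).
apply: injS => //; apply/eqP; rewrite eq_pblock ?covX ?inE //.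
rewrite pblock_equivalence_partition ?inE //; last exact: equivalence_connect.
by apply: connect1; rewrite /adj lt0n.
Qed.

(** The label [f v] names the only tour through [v]. Edges of [T i] stay inside the fibre of [i],
    which [T i] connects, so the components of the sum are exactly the fibres of [f]. *)
Lemma components_sum (I : finType) (f : V -> I) (T : I -> multigraph V) :
  (forall i, connected (T i)) ->
  (forall i, vertices (T i) = [set v | f v == i]) ->
  (forall i, nonempty (T i)) ->
  #|components (\sum_i T i)| = #|I| /\
  forall C, C \in components (\sum_i T i) ->
    exists i, induced (\sum_i T i) C = T i.
Proof.
move=> connT vertT neT; set X := \sum_i T i.
have XE e : X e = (\sum_i T i e)%N by rewrite /X sum_ffunE.
have leTX i e : (T i e <= X e)%N by rewrite XE (bigD1 i) //= leq_addr.
have fT i u v : (0 < T i (mk_edge u v))%N -> f u = i /\ f v = i.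
  move=> Tuv; split; apply/eqP.
    have : u \in vertices (T i) by apply: mem_vertices Tuv _; rewrite set21.
    by rewrite vertT inE.
  have : v \in vertices (T i) by apply: mem_vertices Tuv _; rewrite set22.
  by rewrite vertT inE.
have connE u v : connect (adj X) u v = (f u == f v).
  apply/idP/eqP => [|fuv]; last first.
    by apply: (connect_adj_le (leTX (f u))); apply: connT; rewrite vertT inE ?fuv.
  (* The label is constant along a path, since each edge of the sum comes from some [T i]. *)
  case/connectP=> p; elim: p u => [|w p IHp] u /=; first by move=> _ ->.
  case/andP=> Xuw /IHp{}IHp /IHp <-; move: Xuw; rewrite /adj XE lt0n sum_nat_eq0.
  by rewrite negb_forall => /existsP[i]; rewrite -lt0n => /fT[-> ->].
have compE : components X = [set [set v | f v == i] | i : I].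
  apply/setP=> C; apply/imsetP/imsetP => [[u _ ->]|[i _ ->]].
    by exists (f u) => //; apply/setP=> v; rewrite !inE connE eq_sym.
  have /nonempty_vertices[u] := neT i; rewrite vertT inE => /eqP <-.
  by exists u => //; apply/setP=> v; rewrite !inE connE eq_sym.
split=> [|C]; last first.
  rewrite compE => /imsetP[i _ ->]; exists i; apply/ffunP=> e; rewrite ffunE.
  have [u [v ->]] := mk_edgeP e; rewrite /ends /= subUset !sub1set !inE.
  (* Inside the fibre of [i] the other tours vanish; on all other edges [T i] itself vanishes. *)
  case: ifP => [/andP[/eqP fu /eqP fv]|].
    rewrite XE (bigD1 i) //= big1 ?addn0 // => j ji; apply/eqP; rewrite -leqn0 leqNgt.
    by apply: contra ji => /fT[<-]; rewrite fu.
  have [|] := posnP (T i (mk_edge u v)); first by move=> ->.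
  by move=> /fT[-> ->]; rewrite eqxx.
(* No fibre is empty, so distinct labels have distinct fibres. *)
rewrite compE card_imset // => i j eqij.
have /nonempty_vertices[u] := neT i; rewrite vertT => ui.
have := ui; rewrite eqij inE => /eqP <-; apply/esym/eqP.
by move: ui; rewrite inE.
Qed.

(** * Closed walks as a supply of tours *)

Definition edge1 u v : multigraph V := [ffun e => (e == mk_edge u v) : nat].

Lemma degree_edge1 u v x : degree (edge1 u v) x = ((x == u) + (x == v))%N.
Proof.
rewrite /degree; have [xuv|xuv] := boolP (x \in ends (mk_edge u v)).
  rewrite (bigD1 (mk_edge u v)) //= big1 => [|e /andP[_ /negPf ne]]; last first.
    by rewrite ffunE ne muln0.
  rewrite ffunE eqxx is_loop_mk_edge; move: xuv; rewrite !inE.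
  have [<-|uv] := eqVneq u v; first by rewrite orbb => /eqP->; rewrite eqxx.
  by case/orP=> /eqP->; rewrite eqxx ?(negPf uv) // eq_sym (negPf uv).
rewrite big1 => [|e xe]; last first.
  rewrite ffunE; case: eqP => [eE|]; last by rewrite muln0.
  by rewrite -eE xe in xuv.
by move: xuv; rewrite !inE; do 2![case: eqP].
Qed.

Lemma loop_cost_edge1 u v : loop_cost (edge1 u v) = (u == v).+1.
Proof.
rewrite /loop_cost (bigD1 (mk_edge u v)) //= big1 => [|e /negPf ne].
  by rewrite ffunE eqxx is_loop_mk_edge addn0 mul1n.
by rewrite ffunE ne.
Qed.

(** [s] lists the vertices after the start [x]; an immediate repetition of a vertex produces a
    loop. *)
Fixpoint walk x s : multigraph V :=
  if s is y :: s' then edge1 x y + walk y s' else 0.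

Definition closed_walk x s : multigraph V := walk x (rcons s x).

(** Each vertex of [s] is entered and left, except that the last one is not left and the start is
    left without being entered; the end correction stands on the left to avoid subtraction. *)
Lemma degree_walk x s v :
  (degree (walk x s) v + (v == last x s) = (v == x) + 2 * count_mem v s)%N.
Proof.
elim: s x => [|y s IHs] x /=; first by rewrite degree0 addn0.
by rewrite degreeD degree_edge1 -addnA IHs (eq_sym y v) mulnDr (mul2n (v == y)) -addnn !addnA.
Qed.

Lemma degree_closed_walk x s v :
  degree (closed_walk x s) v = (2 * count_mem v (x :: s))%N.
Proof.
have := degree_walk x (rcons s x) v.
rewrite last_rcons -cats1 count_cat /= (eq_sym x v) /closed_walk -cats1; lia.
Qed.

Lemma degree_sum_closed_walk (I : finType) (P : pred I) (x : I -> V)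
    (s_ : I -> seq V) v :
  degree (\sum_(i | P i) closed_walk (x i) (s_ i)) v =
  (\sum_(i | P i) 2 * count_mem v (x i :: s_ i))%N.
Proof.
by rewrite degree_sum; apply: eq_bigr => i _; apply: degree_closed_walk.
Qed.

Lemma vertices_closed_walk x s : vertices (closed_walk x s) = [set:: x :: s].
Proof.
by apply/setP=> v; rewrite !inE degree_closed_walk muln_gt0 -has_count has_pred1 inE.
Qed.

Lemma path_walk x s : path (adj (walk x s)) x s.
Proof.
elim: s x => //= y s IHs x; apply/andP; split.
  by rewrite /adj !ffunE eqxx.
apply: sub_path (IHs y) => u v; rewrite /adj ffunE => h.
exact: leq_trans h (leq_addl _ _).
Qed.

Lemma tour_closed_walk x s : tour (closed_walk x s).
Proof.
split=> [u v|v]; last by rewrite degree_closed_walk oddM.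
rewrite vertices_closed_walk !inE => us vs.
have conn w : w \in x :: s -> connect (adj (closed_walk x s)) x w.
  move=> ws; apply: (path_connect (path_walk x (rcons s x))).
  by move: ws; rewrite !inE mem_rcons inE => /orP[->|->] //; rewrite !orbT.
by apply: (@connect_trans _ _ x); [rewrite connect_adj_sym|]; apply: conn; rewrite inE.
Qed.

Lemma nonempty_closed_walk x s : nonempty (closed_walk x s).
Proof.
by apply/nonempty_vertices; exists x; rewrite vertices_closed_walk !inE eqxx.
Qed.

(** This form evaluates by computation on explicit walks. *)
Lemma loop_cost_walk x s :
  loop_cost (walk x s) = sumn (pairmap (fun u v => (u == v).+1) x s).
Proof.
elim: s x => [|y s IHs] x /=; first exact: loop_cost0.
by rewrite loop_costD loop_cost_edge1 IHs.
Qed.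

Lemma loop_cost_sum_closed_walk (I : finType) (P : pred I) (x : I -> V)
    (s_ : I -> seq V) :
  loop_cost (\sum_(i | P i) closed_walk (x i) (s_ i)) =
  (\sum_(i | P i)
     sumn (pairmap (fun u v => (u == v).+1) (x i) (rcons (s_ i) (x i))))%N.
Proof. by rewrite loop_cost_sum; apply: eq_bigr => i _; apply: loop_cost_walk. Qed.

(** * The cost function over the reals *)

Section LoopCost.

Variable R : realType.

Definition loop_costs (e : edge V) : R := (is_loop e).+1%:R.

Lemma cost_loop_costs X : cost loop_costs X = (loop_cost X)%:R.
Proof.
rewrite /cost /loop_cost natr_sum; apply: eq_bigr => e _.
by rewrite natrM.
Qed.

(** All costs are 1 or 2, so two costs together, or one doubled, reach at least 2. *)
Lemma metric_loop_costs : metric_cost loop_costs.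
Proof.
split=> [e|u v w|v u _]; rewrite /loop_costs -?natrD -?natrM ?ler0n ?ler_nat //.
  by case: is_loop; case: is_loop; case: is_loop.
by case: is_loop; case: is_loop.
Qed.

Lemma is_opt_loop_costs (P : multigraph V -> Prop) X :
  P X -> (forall Y, P Y -> (loop_cost X <= loop_cost Y)%N) ->
  is_opt loop_costs P (loop_cost X)%:R.
Proof.
move=> PX minX; exists X; split=> // [|Y PY]; first exact: cost_loop_costs.
by rewrite cost_loop_costs ler_nat minX.
Qed.

End LoopCost.

End Multigraphs.

(** * The unrestricted instance *)

Lemma arbitrary_neq_disjoint (R : realType) :
  exists (V : finType) (c : edge V -> R) (r : V -> nat) (m : nat),
     [/\ metric_cost c, forall v : V, (1 <= r v)%N & (1 <= m)%N] /\
     exists opt_arb opt_disj : R,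
       [/\ is_opt c (arbitrary_tours r m) opt_arb,
           is_opt c (disjoint_tours r m) opt_disj
         & opt_arb <> opt_disj].
Proof.
exists bool, (loop_costs R), (fun=> 2%N), 2%N.
split; first by split=> //; apply: metric_loop_costs.
(* Both tours go from [true] to [false] and back, at cost 2 each. *)
pose A : multigraph bool := \sum_(i < 2) closed_walk true [:: false].
(* Each tour consists of two copies of the loop at its only vertex, at cost 4. *)
pose B : multigraph bool := \sum_(b : bool) closed_walk b [:: b].
have costA : loop_cost A = 4%N.
  by rewrite loop_cost_sum_closed_walk !big_ord_recl big_ord0.
have costB : loop_cost B = 8%N.
  by rewrite loop_cost_sum_closed_walk big_bool.
exists (loop_cost A)%:R, (loop_cost B)%:R; split.
- apply: is_opt_loop_costs => [|Y [visY _]].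
    split=> [v|].
      by rewrite /visits degree_sum_closed_walk !big_ord_recl big_ord0; case: v.
    exists (fun=> closed_walk true [:: false]); split=> // i.
    by split; [apply: tour_closed_walk|apply: nonempty_closed_walk].
  (* Both degrees are 4, so the cost is at least half of 8. *)
  have := sum_degree_le Y; rewrite big_bool /= !visY costA; lia.
- apply: is_opt_loop_costs => [|Y [visY cardY neY]].
    have [|||cardB compB] := @components_sum bool bool id (fun b => closed_walk b [:: b]).
    + by move=> b; case: (tour_closed_walk b [:: b]).
    + by move=> b; rewrite vertices_closed_walk; apply/setP=> v; rewrite !inE orbb.
    + by move=> b; apply: nonempty_closed_walk.
    split=> [v||C /compB[b ->]].
    + by rewrite /visits degree_sum_closed_walk big_bool; case: v.
    + by rewrite cardB card_bool.
    + by split; [apply: tour_closed_walk|apply: nonempty_closed_walk].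
  have : (\sum_(v in [set: bool]) degree Y v <= loop_cost Y)%N.
    apply/sum_degree_stable/transversal_stable => [|C /neY[_]].
      by rewrite cardsT card_bool.
    case/nonempty_vertices=> v /(subsetP (vertices_induced Y C)) vC.
    by exists v; rewrite ?inE.
  by rewrite (eq_bigl xpredT) => [|v]; rewrite ?inE // big_bool /= !visY costB.
- by rewrite costA costB => /eqP; rewrite eqr_nat.
Qed.

(** * The instance with depots *)

Lemma depot_arbitrary_neq_disjoint (R : realType) :
  exists (V : finType) (c : edge V -> R) (D : {set V}) (r : V -> nat),
     (metric_cost c /\ forall v : V, v \notin D -> (1 <= r v)%N) /\
     exists opt_arb opt_disj : R,
       [/\ is_opt c (depot_arbitrary_tours D r) opt_arb,
           is_opt c (depot_disjoint_tours D r) opt_disj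
         & opt_arb <> opt_disj].
Proof.
(* The first coordinate tells depots from non-depots; the second pairs each depot with a
   non-depot. *)
pose V : finType := (bool * bool)%type; pose D := [set v : V | v.1].
exists V, (loop_costs R), D, (fun=> 2%N).
split; first by split=> //; apply: metric_loop_costs.
have big_D (h : V -> nat) :
    (\sum_(v in D) h v = h (true, true) + h (true, false))%N.
  rewrite (reindex_onto (pair true) snd) => [|[[] b]]; rewrite ?inE //=.
  by rewrite big_mkcond big_bool !inE.
have big_DC (h : V -> nat) :
    (\sum_(v in ~: D) h v = h (false, true) + h (false, false))%N.
  rewrite (reindex_onto (pair false) snd) => [|[[] b]]; rewrite ?inE //=.
  by rewrite big_mkcond big_bool !inE.
have cardD : #|D| = 2%N by rewrite -sum1_card big_D.
have cardDC : #|~: D| = 2%N by rewrite -sum1_card big_DC.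
(* A triangle through [d] and both non-depots, at cost 3. *)
pose TA (d : V) := closed_walk d [:: (false, true); (false, false)].
(* The edge between a depot and its partner, taken four times: cost 4, with two visits to each
   end. *)
pose TB (b : bool) := closed_walk (true, b) [:: (false, b); (true, b); (false, b)].
pose A := \sum_(d in D) TA d; pose B := \sum_(b : bool) TB b.
have costA : loop_cost A = 6%N.
  by rewrite loop_cost_sum_closed_walk big_D.
have costB : loop_cost B = 8%N.
  by rewrite loop_cost_sum_closed_walk big_bool.
exists (loop_cost A)%:R, (loop_cost B)%:R; split.
- apply: is_opt_loop_costs => [|Y [[visY depY] _]].
    split; first split.
    + move=> v; rewrite inE /visits degree_sum_closed_walk big_D.
      by case: v => [[] []].
    + move=> d; rewrite inE => dD; exists 1%N => //.
      rewrite /visits degree_sum_closed_walk big_D.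
      by case: d dD => [[] []].
    exists TA; split=> // d dD; split; first exact: tour_closed_walk.
      apply/setP=> v; rewrite vertices_closed_walk !inE.
      by move: dD; rewrite inE; case: d => [[] []]; case: v => [[] []].
    split; [exists d => //|exists (false, true)];
      by rewrite ?vertices_closed_walk !inE ?eqxx ?orbT.
  (* Each depot is visited at least once and so has degree at least 2. The degree sum is at least 2
     + 2 + 4 + 4 = 12, and the cost at least 6. *)
  have [[|k1] // _ deg1] := depY (true, true) (in_set _ _).
  have [[|k2] // _ deg2] := depY (true, false) (in_set _ _).
  have := sum_degree_le Y; rewrite (bigID [in D]) /= big_D deg1 deg2.
  rewrite (eq_bigl [in ~: D]) => [|v]; last by rewrite /= in_setC.
  rewrite big_DC !visY ?inE // costA; lia.
- apply: is_opt_loop_costs => [|Y [[visY _] cardY neY]].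
    (* The fibres of [snd] are the pairs of a depot and its partner. *)
    have [|||cardB compB] := @components_sum V bool snd TB.
    + by move=> b; case: (tour_closed_walk (true, b) [:: (false, b); (true, b); (false, b)]).
    + move=> b; rewrite vertices_closed_walk; apply/setP=> v; rewrite !inE.
      by case: v b => [[] []] [].
    + by move=> b; apply: nonempty_closed_walk.
    split=> [||C /compB[b ->]].
    + split=> [v|d]; rewrite inE => vD; last exists 2%N => //;
        rewrite /visits degree_sum_closed_walk big_bool.
        by case: v vD => [[] []].
      by case: d vD => [[] []].
    + by rewrite cardB card_bool cardD.
    + split; first exact: tour_closed_walk.
        rewrite -(cards1 (true, b)); apply: eq_card => v.
        by rewrite vertices_closed_walk !inE; case: v b => [[] []] [].
      split; [exists (true, b)|exists (false, b)];
        by rewrite ?vertices_closed_walk !inE ?eqxx ?orbT.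
  (* There are as many non-depots as components, and each component contains a non-depot. *)
  have : (\sum_(v in ~: D) degree Y v <= loop_cost Y)%N.
    apply/sum_degree_stable/transversal_stable => [|C /neY[_ _ [_ [v vD vY]]]].
      by rewrite cardY cardD cardDC.
    by exists v; rewrite ?in_setC // (subsetP (vertices_induced Y C)).
  by rewrite big_DC !visY ?inE // costB.
- by rewrite costA costB => /eqP; rewrite eqr_nat.
Qed.

Theorem claim2p6 (R : realType) :
  (exists (V : finType) (c : edge V -> R) (r : V -> nat) (m : nat),
     [/\ metric_cost c, forall v : V, (1 <= r v)%N & (1 <= m)%N] /\
     exists opt_arb opt_disj : R,
       [/\ is_opt c (arbitrary_tours r m) opt_arb,
           is_opt c (disjoint_tours r m) opt_disj
         & opt_arb <> opt_disj])
  /\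
  (exists (V : finType) (c : edge V -> R) (D : {set V}) (r : V -> nat),
     (metric_cost c /\ forall v : V, v \notin D -> (1 <= r v)%N) /\
     exists opt_arb opt_disj : R,
       [/\ is_opt c (depot_arbitrary_tours D r) opt_arb,
           is_opt c (depot_disjoint_tours D r) opt_disj
         & opt_arb <> opt_disj]).
Proof.
exact: (conj (arbitrary_neq_disjoint R) (depot_arbitrary_neq_disjoint R)).
Qed.
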